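(* For every prime ideal $P$ minimal over $\mathcal{I}^{\langle n\rangle}$, the $P$-primary component of $\mathcal{I}^{\langle n\rangle}$ equals $P$; that is, the minimal primary components of $\mathcal{I}^{\langle n\rangle}$ are prime ideals.
   Context: Fix positive integers $n, r_1,\dots,r_n$, let $N=[r_1]\times\cdots\times[r_n]$, and let $R$ be the polynomial ring over a field in the variables $x_a$, $a\in N$. For $a,b\in N$ and $i\in[n]$, ${\rm s}(i,a,b)\in N$ is the element whose $i$-th component is $b_i$ and whose other components agree with $a$. Let $d(a,b)=\#\{j: a_j\neq b_j\}$ and $f_{i,a,b}=x_ax_b-x_{{\rm s}(i,a,b)}x_{{\rm s}(i,b,a)}$. Define $\mathcal{I}^{\langle n\rangle}=(f_{i,a,b}: a,b\in N,\ d(a,b)=2,\ i\in[n])$, the ideal generated by the $2\times 2$ minors of all two-dimensional slices of the generic $r_1\times\cdots\times r_n$ hypermatrix. *)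

(* Defs.v *)
From HB Require Import structures.
From mathcomp Require Import all_boot all_order all_algebra.
From mathcomp Require Import mpoly.
Set Implicit Arguments. Unset Strict Implicit. Unset Printing Implicit Defensive.
Import GRing.Theory.
Local Open Scope ring_scope.

Section Ideals.
Variable R : comNzRingType.

Definition is_ideal (I : R -> Prop) : Prop :=
  [/\ I 0, (forall x y, I x -> I y -> I (x + y)) & (forall a x, I x -> I (a * x))].

Definition ideal_gen (G : R -> Prop) : R -> Prop :=
  fun f => exists s : seq (R * R),
      (forall p, p \in s -> G p.2) /\ f = \sum_(p <- s) p.1 * p.2.

Definition sub_ideal (I J : R -> Prop) : Prop := forall x, I x -> J x.

Definition prime_ideal (P : R -> Prop) : Prop :=
  [/\ is_ideal P, ~ P 1 & forall a b, P (a * b) -> P a \/ P b].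

Definition minimal_prime_over (I P : R -> Prop) : Prop :=
  [/\ prime_ideal P, sub_ideal I P &
      forall Q, prime_ideal Q -> sub_ideal I Q -> sub_ideal Q P -> sub_ideal P Q].

(* The P-primary component of I for a minimal prime P of I (isolated component):
   the contraction of I R_P, i.e. { f | s f \in I for some s \notin P }. *)
Definition primary_component (I P : R -> Prop) : R -> Prop :=
  fun f => exists s, ~ P s /\ I (s * f).
End Ideals.

Definition idx (n : nat) (r : 'I_n -> nat) : finType :=
  {dffun forall i : 'I_n, 'I_(r i)}.
Arguments idx : clear implicits.

(* The polynomial ring F[x_a : a \in N], variables numbered via enum_rank. *)
Notation polyR F n r := {mpoly F[#|{: idx n r}|]}.

Definition xvar (F : fieldType) (n : nat) (r : 'I_n -> nat) (a : idx n r) : polyR F n r :=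
  'X_(enum_rank a).

Definition swp (n : nat) (r : 'I_n -> nat) (i : 'I_n) (a b : idx n r) : idx n r :=
  [ffun j => if j == i then b j else a j].

Definition dist (n : nat) (r : 'I_n -> nat) (a b : idx n r) : nat := #|[set j | a j != b j]|.

Definition fgen (F : fieldType) (n : nat) (r : 'I_n -> nat) (i : 'I_n) (a b : idx n r) : polyR F n r :=
  xvar F a * xvar F b - xvar F (swp i a b) * xvar F (swp i b a).

Definition slice_ideal (F : fieldType) (n : nat) (r : 'I_n -> nat) : polyR F n r -> Prop :=
  ideal_gen (fun f : polyR F n r =>
    exists (i : 'I_n) (a b : idx n r), dist a b = 2%N /\ f = fgen F i a b).
Arguments slice_ideal : clear implicits.

(* Main.v *)
(* Let S be the set of a with x_a not in P. If a, b in S are at distance 2, then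
   both swapped indices are in S, since P is prime; hence the Hamming components
   of S are boxes, at mutual distance at least 3. Let phi be the monomial map which
   sends x_a to 0 for a outside S and parametrizes each box of S by a Segre
   variety. An ideal L which contains the slice ideal and all the x_a with a
   outside S, and which is saturated with respect to the x_a with a in S, contains
   ker phi: the minors with indices at distance 2 give all the minors of a box
   after division by variables of S, and these express x_a through the star of a
   base point of its box. Taking L = P gives P = ker phi by minimality.

   Let J be the P-primary component. To take L = J one needs x_c in J for c
   outside S. If c is at distance at least 3 from S, then adjoining {c} to S as
   a new box gives a smaller prime. If c is adjacent to a box, then either the
   box can be enlarged by the slice through c, again giving a smaller prime, or
   another box is at distance 2 from that slice, which gives a relation
   x_b (x_e x_b0 - x_v x_w) in the slice ideal whose second factor is not in P.
   Distance 2 reduces to distance 1 by a single minor. Hence P = ker phi is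
   contained in J. *)
Require Import Defs.
From HB Require Import structures.
From mathcomp Require Import all_boot all_order all_algebra.
From mathcomp Require Import mpoly boolp ring.
Set Implicit Arguments. Unset Strict Implicit. Unset Printing Implicit Defensive.
Import GRing.Theory.
Local Open Scope ring_scope.

(** * Ideals and congruences modulo an ideal *)

Section IdealTheory.
Variables (R : comNzRingType) (L : R -> Prop).
Hypothesis idL : is_ideal L.

Lemma ideal0 : L 0. Proof. by case: idL. Qed.

Lemma idealD x y : L x -> L y -> L (x + y).
Proof. by case: idL => _ + _; apply. Qed.

Lemma idealMl a x : L x -> L (a * x).
Proof. by case: idL => _ _; apply. Qed.

Lemma idealMr x a : L x -> L (x * a).
Proof. by rewrite mulrC; apply: idealMl. Qed.

Lemma idealN x : L x -> L (- x).
Proof. by rewrite -mulN1r; apply: idealMl. Qed.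

Lemma idealB x y : L x -> L y -> L (x - y).
Proof. by move=> Lx Ly; apply: idealD => //; apply: idealN. Qed.

Lemma ideal_sum (I : eqType) (s : seq I) (Q : pred I) (f : I -> R) :
  (forall i, i \in s -> Q i -> L (f i)) -> L (\sum_(i <- s | Q i) f i).
Proof.
move=> Lf; rewrite big_seq_cond; apply: big_ind => [|x y|i /andP[]].
- exact: ideal0.
- exact: idealD.
- exact: Lf.
Qed.

Lemma ideal_congM x x' y y' : L (x - x') -> L (y - y') -> L (x * y - x' * y').
Proof.
move=> Lx Ly; have -> : x * y - x' * y' = y * (x - x') + x' * (y - y') by ring.
by apply: idealD; apply: idealMl.
Qed.

Lemma ideal_cong_prod (I : Type) (s : seq I) (Q : pred I) (f g : I -> R) :
  (forall i, L (f i - g i)) ->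
  L (\prod_(i <- s | Q i) f i - \prod_(i <- s | Q i) g i).
Proof.
move=> Lfg; elim: s => [|i s IH]; first by rewrite !big_nil subrr; exact: ideal0.
by rewrite !big_cons; case: (Q i) => //; apply: ideal_congM.
Qed.

Lemma ideal_cong_exp x y k : L (x - y) -> L (x ^+ k - y ^+ k).
Proof.
move=> Lxy; elim: k => [|k IH]; first by rewrite !expr0 subrr; exact: ideal0.
by rewrite !exprS; apply: ideal_congM.
Qed.

Lemma ideal_poly : is_ideal (fun g : {poly R} => forall k, L g`_k).
Proof.
split=> [k|x y Lx Ly k|a x Lx k]; first by rewrite coef0; exact: ideal0.
  by rewrite coefD; apply: idealD.
by rewrite coefM; apply: ideal_sum => j _ _; apply: idealMl.
Qed.

Lemma ideal_gen_min (G : R -> Prop) :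
  (forall x, G x -> L x) -> sub_ideal (ideal_gen G) L.
Proof.
move=> GL _ [s [Gs ->]]; apply: ideal_sum => p /Gs Gp _.
by apply: idealMl; apply: GL.
Qed.

End IdealTheory.

Lemma ideal_gen_ideal (R : comNzRingType) (G : R -> Prop) : is_ideal (ideal_gen G).
Proof.
split=> [|_ _ [s [Gs ->]] [t [Gt ->]]|a _ [s [Gs ->]]].
- by exists [::]; split=> //; rewrite big_nil.
- exists (s ++ t); split; last by rewrite big_cat.
  by move=> p; rewrite mem_cat => /orP[/Gs|/Gt].
- exists [seq (a * p.1, p.2) | p <- s]; split; first by move=> _ /mapP[p /Gs ? ->].
  by rewrite big_map mulr_sumr; apply: eq_bigr => p _; rewrite mulrA.
Qed.

Lemma sub_ideal_gen (R : comNzRingType) (G : R -> Prop) x : G x -> ideal_gen G x.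
Proof.
move=> Gx; exists [:: (1, x)]; split; first by move=> p; rewrite inE => /eqP->.
by rewrite big_seq1 mul1r.
Qed.

(** * Isolated primary components *)

Section PrimaryComponent.
Variables (R : comNzRingType) (I P : R -> Prop).
Hypotheses (idI : is_ideal I) (prP : prime_ideal P).

Lemma prime_notM s t : ~ P s -> ~ P t -> ~ P (s * t).
Proof. by case: prP => _ _ PM Ps Pt /PM[]. Qed.

Lemma primary_component_ideal : is_ideal (primary_component I P).
Proof.
case: prP => idP P1 PM; split=> [|x y [s [Ps Isx]] [t [Pt Ity]]|a x [s [Ps Isx]]].
- by exists 1; split=> //; rewrite mulr0; apply: ideal0.
- exists (s * t); split; first exact: prime_notM.
  have -> : s * t * (x + y) = t * (s * x) + s * (t * y) by ring.
  by apply: idealD => //; apply: idealMl.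
- by exists s; split=> //; rewrite mulrCA; apply: idealMl.
Qed.

Lemma sub_primary_component : sub_ideal I (primary_component I P).
Proof. by case: prP => _ P1 _ x Ix; exists 1; rewrite mul1r. Qed.

Lemma primary_component_saturated s x :
  ~ P s -> primary_component I P (s * x) -> primary_component I P x.
Proof.
move=> Ps [t [Pt Itsx]]; exists (t * s); split; first exact: prime_notM.
by rewrite -mulrA.
Qed.

Lemma primary_component_sub : sub_ideal I P -> sub_ideal (primary_component I P) P.
Proof. by case: prP => _ _ PM IP x [s [Ps /IP/PM[]]]. Qed.

End PrimaryComponent.

(** Stated as a congruence so that it yields equality of maps, with [L] the zero ideal, as well as
    coefficientwise congruence of maps into a polynomial ring. *)
Lemma mpoly_rmorph_cong (F R : comNzRingType) (n : nat) (L : R -> Prop)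
    (g h : {rmorphism {mpoly F[n]} -> R}) :
  is_ideal L -> (forall c, g c%:MP = h c%:MP) ->
  (forall i, L (g 'X_i - h 'X_i)) -> forall p, L (g p - h p).
Proof.
move=> idL ghC ghX p; rewrite (mpolyE p) (rmorph_sum g) (rmorph_sum h) -sumrB /=.
apply: ideal_sum => // m _ _; rewrite -mul_mpolyC !rmorphM /= ghC.
apply: ideal_congM => //; first by rewrite subrr; apply: ideal0.
rewrite mpolyXE_id !rmorph_prod; apply: ideal_cong_prod => // i.
by rewrite !rmorphXn; apply: ideal_cong_exp.
Qed.

(** * Hamming distance and coordinate swaps *)

Section Hamming.
Variables (n : nat) (r : 'I_n -> nat).
Implicit Types (a b c : idx n r) (i j k : 'I_n).

Lemma dist_sym a b : dist a b = dist b a.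
Proof. by apply: eq_card => k; rewrite !inE eq_sym. Qed.

Lemma dist_le1 i a b : (forall k, k != i -> a k = b k) -> (dist a b <= 1)%N.
Proof.
move=> eqab; rewrite -(cards1 i) subset_leq_card //; apply/subsetP => k.
by rewrite !inE; apply: contraNT => /eqab->.
Qed.

Lemma dist_le2 i j a b :
  (forall k, k != i -> k != j -> a k = b k) -> (dist a b <= 2)%N.
Proof.
move=> eqab; apply: leq_trans (_ : #|[set i; j]| <= _)%N; last first.
  by rewrite cards2; case: (_ != _).
rewrite subset_leq_card //; apply/subsetP => k.
by rewrite !inE; apply: contraNT; rewrite negb_or => /andP[ki kj]; rewrite eqab.
Qed.

Lemma dist0 a b : dist a b = 0%N -> a = b.
Proof.
move=> /cards0_eq ab0; apply/ffunP => k; apply/eqP.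
by have := in_set0 k; rewrite -ab0 inE => /negbFE.
Qed.

Lemma dist1 a b :
  dist a b = 1%N -> exists2 i, a i != b i & forall k, k != i -> a k = b k.
Proof.
move/eqP/cards1P => [i /setP Ei]; exists i; first by have := Ei i; rewrite !inE eqxx.
by move=> k ki; apply/eqP; have := Ei k; rewrite !inE (negbTE ki) => /negbFE.
Qed.

Lemma dist2 a b : dist a b = 2%N -> exists i j,
  [/\ i != j, a i != b i, a j != b j & forall k, k != i -> k != j -> a k = b k].
Proof.
move/eqP/cards2P => [i [j [ij /setP E]]]; exists i, j; split=> //.
- by have := E i; rewrite !inE eqxx.
- by have := E j; rewrite !inE eqxx orbT.
- move=> k ki kj; apply/eqP; have := E k.
  by rewrite !inE (negbTE ki) (negbTE kj) => /negbFE.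
Qed.

Lemma swp_id i a : swp i a a = a.
Proof. by apply/ffunP => k; rewrite ffunE if_same. Qed.

Lemma dist_swp i a b : (dist a (swp i a b) <= 1)%N.
Proof. by apply: (@dist_le1 i) => k ki; rewrite ffunE (negbTE ki). Qed.

Lemma swp_dist_le1 i a b : (dist a b <= 1)%N ->
  (swp i a b = a /\ swp i b a = b) \/ (swp i a b = b /\ swp i b a = a).
Proof.
rewrite leq_eqVlt ltnS leqn0 => /orP[/eqP/dist1[j _ eqab]|/eqP/dist0->]; last first.
  by left; rewrite swp_id.
have [ij|ij] := eqVneq i j; [right|left]; split; apply/ffunP => k; rewrite ffunE.
- by case: eqVneq => //; rewrite ij => /eqab.
- by case: eqVneq => //; rewrite ij => /eqab.
- by case: eqVneq => // ->; rewrite eqab.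
- by case: eqVneq => // ->; rewrite eqab.
Qed.

Lemma dist_swp_lt k a b : a k != b k -> (dist (swp k a b) b < dist a b)%N.
Proof.
move=> abk; apply: proper_card; apply/properP; split.
  apply/subsetP => j; rewrite !inE !ffunE; case: (j =P k) => // ->.
  by rewrite eqxx.
by exists k; rewrite !inE ?ffunE ?eqxx.
Qed.

Lemma dist_swp_swp j a b : dist (swp j a b) (swp j b a) = dist a b.
Proof. by apply: eq_card => k; rewrite !inE !ffunE; case: (k == j) => //; rewrite eq_sym. Qed.

Lemma swp_swp j a b : swp j (swp j a b) (swp j b a) = a.
Proof. by apply/ffunP => k; rewrite !ffunE; case: (k == j). Qed.

Lemma dist_gt0P a b : (0 < dist a b)%N -> exists k, a k != b k.
Proof. by case/card_gt0P => k; rewrite inE; exists k. Qed.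

End Hamming.

(** At distance at most 1 a swap fixes or exchanges the two indices, so [fgen] is 0. *)
Lemma fgen_slice (F : fieldType) (n : nat) (r : 'I_n -> nat) i (a b : idx n r) :
  (dist a b <= 2)%N -> slice_ideal F n r (fgen F i a b).
Proof.
have idI := ideal_gen_ideal
  (fun f => exists i (a b : idx n r), dist a b = 2%N /\ f = fgen F i a b).
rewrite leq_eqVlt => /orP[/eqP ab|]; first by apply: sub_ideal_gen; exists i, a, b.
rewrite ltnS /fgen => /(swp_dist_le1 i)[[-> ->]|[-> ->]]; rewrite ?(mulrC (xvar F b));
by rewrite subrr; exact: ideal0.
Qed.

(** * Monomial maps given by labellings, and their prime kernels *)

Section Toric.
Variables (F : fieldType) (n : nat) (r : 'I_n -> nat).
Implicit Types (a b c l : idx n r) (i j k : 'I_n) (lab : idx n r -> option (idx n r)).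

(** A Segre coordinate y_(l, i, t) has t in ['I_(r i)], which depends on i; encoding t by a full
    index keeps this a plain product type. *)
Definition toric_index : finType := (idx n r * 'I_n * idx n r)%type.
Local Notation K := toric_index.
Local Notation Y := {mpoly F[#|{: toric_index}|]}.

Definition yvar (t : K) : Y := 'X_(enum_rank t).

(* Since [swp i l a] depends on [a] only through [a i], the variable
   [yvar (l, i, swp i l a)] is the Segre coordinate y_(l, i, a_i). *)
Definition segre l a : Y := \prod_i yvar (l, i, swp i l a).

(* A labelling is a partition of part of the index set: [lab a = Some l] puts [a]
   in the component represented by [l], and [lab a = None] means that x_a is sent
   to 0. *)
Definition toric_image lab (v : 'I_#|{: idx n r}|) : Y :=
  oapp (fun l => segre l (enum_val v)) 0 (lab (enum_val v)).

Definition toric lab (p : polyR F n r) : Y := mmap (@mpolyC _ F) (toric_image lab) p.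

HB.instance Definition _ lab := GRing.RMorphism.copy (toric lab)
  (mmap (@mpolyC _ F) (toric_image lab)).

Lemma toric_xvar lab a : toric lab (xvar F a) = oapp (fun l => segre l a) 0 (lab a).
Proof. by rewrite /toric /xvar mmapX mmap1U /toric_image enum_rankK. Qed.

Lemma toricC lab (x : F) : toric lab x%:MP = x%:MP.
Proof. exact: mmapC. Qed.

Lemma segre_neq0 l a : segre l a != 0.
Proof.
by apply/prodf_neq0 => i _; apply/eqP => /(congr1 (mcoeff U_(enum_rank (l, i, swp i l a))));
  rewrite mcoeffX eqxx mcoeff0; apply/eqP/oner_neq0.
Qed.

Lemma toric_xvar_eq0 lab a : toric lab (xvar F a) = 0 <-> lab a = None.
Proof.
rewrite toric_xvar; case: (lab a) => [l|] //=; split=> // /eqP.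
by rewrite (negbTE (segre_neq0 _ _)).
Qed.

Lemma segre_swp l j a b :
  segre l a * segre l b = segre l (swp j a b) * segre l (swp j b a).
Proof.
rewrite -!big_split; apply: eq_bigr => i _ /=.
have [ij|ij] := eqVneq i j.
  rewrite mulrC; congr (yvar (l, i, _) * yvar (l, i, _)); apply/ffunP => k;
  by rewrite !ffunE; case: eqVneq => // ->; rewrite ij eqxx.
by congr (yvar (l, i, _) * yvar (l, i, _)); apply/ffunP => k;
  rewrite !ffunE; case: eqVneq => // ->; rewrite (negbTE ij).
Qed.

Lemma toric_ker_prime lab : prime_ideal (fun f => toric lab f = 0).
Proof.
split=> [||f g] /=.
- split=> [|f g f0 g0|f g g0] /=; first exact: rmorph0.
    by rewrite rmorphD /= f0 g0 addr0.
  by rewrite rmorphM /= g0 mulr0.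
- by rewrite rmorph1; apply/eqP/oner_neq0.
- by rewrite rmorphM => /eqP; rewrite mulf_eq0 => /orP[]/eqP; [left|right].
Qed.

Definition good_labelling lab := forall j a b l l',
  dist a b = 2%N -> lab a = Some l -> lab b = Some l' ->
  l = l' /\ lab (swp j a b) = Some l.

Lemma slice_toric_ker lab :
  good_labelling lab -> sub_ideal (slice_ideal F n r) (fun f => toric lab f = 0).
Proof.
move=> good; have [idK _ _] := toric_ker_prime lab.
apply: (ideal_gen_min idK) => _ [j [a [b [dab ->]]]].
have dba : dist b a = 2%N by rewrite dist_sym.
have dss : dist (swp j a b) (swp j b a) = 2%N by rewrite dist_swp_swp.
have dss' : dist (swp j b a) (swp j a b) = 2%N by rewrite dist_swp_swp.
rewrite rmorphB !rmorphM /= !toric_xvar.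
case Ea: (lab a) => [l|]; case Eb: (lab b) => [l'|] /=.
- have [ll' ->] := good j _ _ _ _ dab Ea Eb.
  have [_ ->] := good j _ _ _ _ dba Eb Ea.
  by rewrite -ll' /= (segre_swp l j) subrr.
all: case Es: (lab (swp j a b)) => [m|]; case Es': (lab (swp j b a)) => [m'|];
  rewrite /= ?(mul0r, mulr0, subrr) //.
(* One of [a], [b] is unlabelled and both swapped indices are labelled; swapping these back would
   label [a] and [b]. *)
all: have [_] := good j _ _ _ _ dss Es Es'.
all: have [_] := good j _ _ _ _ dss' Es' Es.
all: by rewrite !swp_swp ?Ea ?Eb.
Qed.

(* [toric lab] is [toric lab'] followed by killing the variable y_(l0, i, c_i). *)
Lemma toric_ker_restrict lab lab' l0 i c :
  (forall a, lab a =
     if (lab' a == Some l0) && (a i == c i) then None else lab' a) ->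
  forall f, toric lab' f = 0 -> toric lab f = 0.
Proof.
move=> labE f f0.
pose y0 : K := (l0, i, swp i l0 c).
pose th : {rmorphism Y -> Y} :=
    mmap (@mpolyC #|{: K}| F) (fun v : 'I_#|{: K}| => if enum_val v == y0 then 0 else 'X_v).
have thy t : th (yvar t) = if t == y0 then 0 else yvar t.
  by rewrite /th /= /yvar mmapX mmap1U enum_rankK.
suff E : toric lab f - th (toric lab' f) = 0.
  by move/eqP: E; rewrite subr_eq0 f0 => /eqP->; rewrite rmorph0.
apply: (mpoly_rmorph_cong (L := eq^~ 0) (g := toric lab) (h := th \o toric lab')).
- by split=> [|x y -> ->|a x ->]; rewrite ?addr0 ?mulr0.
- by move=> x /=; rewrite !toricC mmapC.
move=> v; rewrite /= -(enum_valK v) -/(xvar F _); move: (enum_val v) => a.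
apply/eqP; rewrite subr_eq0 !toric_xvar labE; apply/eqP.
case: (lab' a) => [l|] /=; last by rewrite rmorph0.
rewrite -[_ == Some l0]/(l == l0) rmorph_prod.
under eq_bigr => j _ do rewrite thy /y0 !xpair_eqE.
case: ifPn => [/andP[/eqP-> /eqP ac]|].
  rewrite (bigD1 i) //= !eqxx /= ifT ?mul0r //.
  by apply/eqP/ffunP => k; rewrite !ffunE; case: eqVneq => // ->.
move=> ne; apply: eq_bigr => j _; rewrite ifN //; apply: contraNN ne.
case/andP=> /andP[/eqP-> /eqP->] /eqP/ffunP/(_ i).
by rewrite !ffunE eqxx => ->; rewrite !eqxx.
Qed.

(** Minimality in the form used below: the kernel of [toric lab'] is a prime between the slice ideal
    and [P], hence equals [P], so [lab'] labels no new index. *)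
Lemma minimal_prime_labelling P lab lab' l0 i c :
  minimal_prime_over (slice_ideal F n r) P ->
  (forall f, P f <-> toric lab f = 0) -> good_labelling lab' ->
  (forall a, lab a =
     if (lab' a == Some l0) && (a i == c i) then None else lab' a) ->
  forall a, lab a = None -> lab' a = None.
Proof.
move=> [_ _ minP] Pker good' labE a la.
apply/toric_xvar_eq0; apply: (minP _ (toric_ker_prime lab')).
- exact: slice_toric_ker.
- by move=> f f0; apply/Pker; apply: toric_ker_restrict labE _ f0.
- by apply/Pker/toric_xvar_eq0.
Qed.

End Toric.

(** * Saturated ideals containing the kernel of a monomial map *)

Section ToricKernelBound.
Variables (F : fieldType) (n : nat) (r : 'I_n -> nat).
Implicit Types (a b c l : idx n r) (i j k : 'I_n).
Variables (lab : idx n r -> option (idx n r)) (L : polyR F n r -> Prop).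
Hypothesis idL : is_ideal L.
Hypothesis sliceL : sub_ideal (slice_ideal F n r) L.
Hypothesis L_unlabelled : forall a, lab a = None -> L (xvar F a).
Hypothesis L_saturated : forall a l f, lab a = Some l -> L (xvar F a * f) -> L f.
Hypothesis labK : forall a l, lab a = Some l -> lab l = Some l.
Hypothesis lab_swp : forall j a b l,
  lab a = Some l -> lab b = Some l -> lab (swp j a b) = Some l.
Local Notation x := (xvar F).

(** Induction on the distance: [b'] is one coordinate [k] closer to [a]. The minors of [a], [b'] and
    of [b], [c], the latter at distance at most 2, combine to [x c * x b'] times the desired minor,
    and saturation cancels the factor. *)
Lemma fgen_component j a b l : lab a = Some l -> lab b = Some l -> L (fgen F j a b).
Proof.
have [m] := ubnP (dist a b); elim: m a b => // m IH a b; rewrite ltnS => dm la lb.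
have [d2|d3] := leqP (dist a b) 2; first exact/sliceL/fgen_slice.
have [k abk kj] : exists2 k, a k != b k & k != j.
  have /card_gt1P[k [k' [+ + kk']]] := ltn_trans (ltnSn 1) d3.
  rewrite !inE => abk abk'; have [kj|] := eqVneq k j; last by exists k.
  by exists k' => //; rewrite -kj eq_sym.
pose b' := swp k b a; pose c := swp j b' a.
have lb' : lab b' = Some l by apply: lab_swp.
have lc : lab c = Some l by apply: lab_swp.
have db' : (dist a b' < m)%N.
  by apply: leq_trans dm; rewrite dist_sym (dist_sym a) dist_swp_lt // eq_sym.
have dbc : (dist b c <= 2)%N.
  by apply: (@dist_le2 _ _ j k) => h hj hk; rewrite !ffunE (negbTE hj) (negbTE hk).
have := sliceL (@fgen_slice F n r j b c dbc).
have := IH a b' db' la lb'.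
rewrite /fgen; set s := swp j a b; set t := swp j b a.
have -> : swp j a b' = s.
  by apply/ffunP => h; rewrite !ffunE; case: eqVneq => // ->; rewrite eq_sym (negbTE kj).
have -> : swp j b c = t by apply/ffunP => h; rewrite !ffunE; case: eqVneq.
have -> : swp j c b = b'.
  by apply/ffunP => h; rewrite !ffunE; case: eqVneq => // ->; rewrite eq_sym (negbTE kj).
rewrite -/c => L1 L2; apply: (L_saturated lb'); apply: (L_saturated lc).
have -> : x c * (x b' * (x a * x b - x s * x t)) =
  x b * x c * (x a * x b' - x s * x c) + x s * x c * (x b * x c - x t * x b') by ring.
by apply: idealD => //; apply: idealMl.
Qed.

Lemma xvar_star a l : lab a = Some l ->
  L (x a * x l ^+ n - x l * \prod_i x (swp i l a)).
Proof.
move=> la; have ll := labK la.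
(* The index [p m] runs from [l] to [a]; each coordinate costs one minor and one factor [x l]. *)
pose p m : idx n r := [ffun j : 'I_n => if (j < m)%N then a j else l j].
suff /(_ n (leqnn n))[_] : forall m, (m <= n)%N -> lab (p m) = Some l /\
    L (x (p m) * x l ^+ m - x l * \prod_(i < n | (i < m)%N) x (swp i l a)).
  rewrite (_ : p n = a); last by apply/ffunP => k; rewrite ffunE ltn_ord.
  have -> // : \prod_(i < n | (i < n)%N) x (swp i l a) = \prod_i x (swp i l a).
  by apply: eq_bigl => i; rewrite ltn_ord.
elim=> [|m IH] mn.
  have -> : p 0%N = l by apply/ffunP => k; rewrite ffunE.
  by rewrite big_pred0 // expr0 !mulr1 subrr; split=> //; exact: ideal0.
have [lp Lp] := IH (ltnW mn); pose k := Ordinal mn.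
have pE : p m.+1 = swp k (p m) a.
  apply/ffunP => h; rewrite !ffunE ltnS leq_eqVlt -[(h : nat) == m]/(h == k).
  by case: eqVneq.
have lp' : lab (p m.+1) = Some l by rewrite pE; apply: lab_swp.
split=> //; have := fgen_component k lp' ll; rewrite /fgen.
have -> : swp k (p m.+1) l = p m.
  rewrite pE; apply/ffunP => h; rewrite !ffunE.
  by case: eqVneq => // ->; rewrite ltnn.
have -> : swp k l (p m.+1) = swp k l a.
  by rewrite pE; apply/ffunP => h; rewrite !ffunE; case: eqVneq => // ->; rewrite eqxx.
move=> L1; rewrite (bigD1 k) /= ?ltnSn //.
rewrite (eq_bigl (fun i : 'I_n => (i < m)%N)); last first.
  move=> i; rewrite ltnS [RHS]ltn_neqAle andbC.
  by rewrite -[i != k]/((i : nat) != m).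
set q := \prod_(i < n | _) _ in Lp *; rewrite exprS.
have -> : x (p m.+1) * (x l * x l ^+ m) - x l * (x (swp k l a) * q) =
  x l ^+ m * (x (p m.+1) * x l - x (p m) * x (swp k l a)) +
  x (swp k l a) * (x (p m) * x l ^+ m - x l * q) by ring.
by apply: idealD => //; apply: idealMl.
Qed.

(** A common denominator for the relations [xvar_star] of all components, with labelled variables as
    factors, so that it cancels modulo [L]. [E l] is the cofactor of [x l ^+ n]. *)
Let D : polyR F n r := \prod_(l | lab l != None) x l ^+ n.
Let E l : polyR F n r := \prod_(l' | (lab l' != None) && (l' != l)) x l' ^+ n.

Lemma toric_denominator a l : lab a = Some l -> D = x l ^+ n * E l.
Proof. by move=> /labK ll; rewrite /D (bigD1 l) ?ll. Qed.

Lemma toric_denominator_saturated m f : L (D ^+ m * f) -> L f.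
Proof.
have sat_exp a l q h : lab a = Some l -> L (x a ^+ q * h) -> L h.
  move=> la; elim: q => [|q IH]; first by rewrite mul1r.
  by rewrite exprS -mulrA => /(L_saturated la)/IH.
elim: m => [|m IH]; first by rewrite mul1r.
rewrite exprS -mulrA => LD; apply: IH; move: LD; rewrite /D.
apply: (big_ind (fun d => forall h, L (d * h) -> L h)).
- by move=> h; rewrite mul1r.
- by move=> d d' Hd Hd' h; rewrite -mulrA => /Hd/Hd'.
- by move=> l; case El: (lab l) => [l'|] // _ h; apply: sat_exp El.
Qed.

Lemma toric_homogeneous_parts f :
  (forall m, L (\sum_(u <- msupp f | mdeg u == m) f@_u *: 'X_[u])) -> L f.
Proof.
move=> Lf; suff -> : f = \sum_(m < msize f)
    \sum_(u <- msupp f | mdeg u == m) f@_u *: 'X_[u].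
  exact: ideal_sum.
rewrite (exchange_big_dep xpredT) //= {1}(mpolyE f) !big_seq; apply: eq_bigr => u uf.
by rewrite (big_pred1 (Ordinal (msize_mdeg_lt uf))).
Qed.

(* [rho] is a section of [toric lab] modulo [L] up to the denominator [D]: it
   sends the image of [x a] to ['X * D * x a], where ['X] stands for 1/D. The
   powers of ['X] keep the homogeneous parts of [f] apart. *)
Lemma toric_ker_sub (i0 : 'I_n) f : toric lab f = 0 -> L f.
Proof.
pose C : {rmorphism F -> {poly polyR F n r}} := polyC \o @mpolyC _ F.
pose rho : {rmorphism {mpoly F[#|{: toric_index r}|]} -> {poly polyR F n r}} :=
  mmap C (fun v : 'I_#|{: toric_index r}| =>
    let: (l, i, w) := enum_val v in
    (* Only the coordinate [i0] carries the extra factor, so it occurs exactly once in the image of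
       each Segre monomial. *)
    (x w)%:P * if i == i0 then 'X * (x l * E l)%:P else 1).
pose phi : {rmorphism polyR F n r -> {poly polyR F n r}} :=
  mmap C (fun v : 'I_#|{: idx n r}| => 'X * (D * 'X_v)%:P).
move=> f0.
have rhoS l a : rho (segre F l a) = 'X * (x l * E l * \prod_i x (swp i l a))%:P.
  rewrite /segre rmorph_prod.
  have rhoY i : rho (yvar F (l, i, swp i l a)) =
      (x (swp i l a))%:P * if i == i0 then 'X * (x l * E l)%:P else 1.
    by rewrite /= /yvar mmapX mmap1U enum_rankK.
  under eq_bigr do rewrite rhoY.
  rewrite big_split /= -big_mkcond big_pred1_eq mulrC.
  have <- : (\prod_i x (swp i l a))%:P = \prod_i (x (swp i l a))%:P.
    by rewrite rmorph_prod.
  by rewrite (polyCM (x l * E l)) mulrA.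
have LXC u m : L u -> L ('X * u%:P)`_m.
  by move=> Lu; rewrite coefXM coefC; case: m => [|[|m]] //=; exact: ideal0.
have Lphi m : L (phi f)`_m.
  rewrite -[phi f]subr0 -(rmorph0 rho) -f0; move: m.
  apply: (mpoly_rmorph_cong (ideal_poly idL) (g := phi) (h := rho \o toric lab)).
    by move=> c; rewrite /= toricC !mmapC.
  move=> v k; rewrite /= mmapX mmap1U -(enum_valK v) -/(x _); move: (enum_val v) => a.
  rewrite toric_xvar; case Ea: (lab a) => [l|] /=.
    rewrite -[mmap _ _ _]/(rho _) rhoS (toric_denominator Ea) -mulrBr -rmorphB /=.
    apply: LXC; have -> : x l ^+ n * E l * x a - x l * E l * \prod_i x (swp i l a) =
      E l * (x a * x l ^+ n - x l * \prod_i x (swp i l a)) by ring.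
    by apply: idealMl => //; apply: xvar_star.
  by rewrite mmap0 subr0; apply: LXC; apply: idealMl => //; apply: L_unlabelled.
apply: toric_homogeneous_parts => m; apply: (@toric_denominator_saturated m).
(* Each variable contributes ['X * D], so the coefficient of ['X^m] isolates the part of degree [m],
   multiplied by [D ^+ m]. *)
suff <- : (phi f)`_m = D ^+ m * \sum_(u <- msupp f | mdeg u == m) f@_u *: 'X_[u] by [].
rewrite /phi /= /mmap coef_sum mulr_sumr [RHS]big_mkcond /=; apply: eq_bigr => u _.
have -> : mmap1 (fun v : 'I_#|{: idx n r}| => 'X * (D * 'X_v)%:P) u =
    'X^(mdeg u) * (D ^+ mdeg u * 'X_[u])%:P.
  rewrite /mmap1 mdegE -!prodrXr mpolyXE_id -big_split rmorph_prod -big_split /=.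
  by apply: eq_bigr => v _; rewrite exprMn -rmorphXn exprMn.
rewrite mulrCA coefXnM -polyCM coefC subn_eq0.
by case: ltngtP => //= ->; rewrite mul_mpolyC scalerAr.
Qed.

End ToricKernelBound.

(** * Hamming components of a set closed under swaps at distance 2 *)

Section Components.
Variables (n : nat) (r : 'I_n -> nat) (S : {set idx n r}).
Implicit Types (a b c l : idx n r) (i j k : 'I_n).
Hypothesis S_switch : forall j a b,
  dist a b = 2%N -> a \in S -> b \in S -> swp j a b \in S.

Let e : rel (idx n r) := fun a b => [&& a \in S, b \in S & (dist a b <= 1)%N].

Let e_sym : connect_sym e.
Proof. by apply: sym_connect_sym => a b; rewrite /e dist_sym andbCA. Qed.

Let e_closed a b : connect e a b -> (a \in S) = (b \in S).
Proof. by apply: closed_connect => c d /and3P[-> ->]. Qed.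

Let e_switch j a b : (dist a b <= 2)%N -> a \in S -> b \in S -> connect e a (swp j a b).
Proof.
move=> dab aS bS; apply: connect1; rewrite /e aS dist_swp andbT.
move: dab; rewrite leq_eqVlt ltnS => /orP[/eqP dab|]; first exact: S_switch.
by case/(swp_dist_le1 j) => -[-> _].
Qed.

Let e_dist2 a b : (dist a b <= 2)%N -> a \in S -> b \in S -> connect e a b.
Proof.
move=> dab aS bS; move: (dab); rewrite leq_eqVlt ltnS => /orP[/eqP/dist2|dab1]; last first.
  by apply: connect1; rewrite /e aS bS.
case=> i [j [_ _ _ eqab]]; have ac := e_switch i dab aS bS.
apply: (connect_trans ac); apply: connect1; rewrite /e -(e_closed ac) aS bS.
by apply: (@dist_le1 _ _ j) => k kj; rewrite ffunE; case: eqVneq => // ki; rewrite eqab.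
Qed.

(* Steps of a path in different coordinates commute, so all the steps in
   coordinate [i] can be made first. *)
Let e_swp i a b : a \in S -> connect e a b -> connect e a (swp i a b).
Proof.
move=> aS /connectP[p]; elim: p a aS => [|c p IH] a aS /=.
  by move=> _ ->; rewrite swp_id; exact: connect0.
case/andP=> eac pp eb; have [_ cS dac] := and3P eac.
have cb : connect e c (swp i c b) by apply: IH.
(* By induction [swp i c b] lies in [S]; it differs from [a] at most in [i] and in the coordinate of
   the first step, so [e_switch] applies. *)
have -> : swp i a b = swp i a (swp i c b).
  by apply/ffunP => h; rewrite !ffunE; case: eqVneq.
apply: e_switch => //; last by rewrite -(e_closed cb).
have [k eqac] : exists k, forall h, h != k -> a h = c h.
  move: dac; rewrite leq_eqVlt ltnS leqn0 => /orP[/eqP/dist1[k _ eqac]|/eqP/dist0->].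
    by exists k.
  by exists i.
by apply: (@dist_le2 _ _ i k) => h hi hk; rewrite ffunE (negbTE hi) eqac.
Qed.

(** The label is the canonical root of the connected component. Closure under swaps comes from
    [e_swp], and separation of the components from [e_dist2]. *)
Lemma component_labelling : exists lab : idx n r -> option (idx n r),
  [/\ forall a, lab a = None <-> a \notin S,
      forall a l, lab a = Some l -> lab l = Some l,
      forall j a b l, lab a = Some l -> lab b = Some l -> lab (swp j a b) = Some l &
      forall a b l l', (dist a b <= 2)%N -> lab a = Some l -> lab b = Some l' -> l = l'].
Proof.
exists (fun a => if a \in S then Some (fingraph.root e a) else None).
split=> [a|a l|j a b l|a b l l' dab]; case: ifP => aS //.
- move=> [<-]; have ac := connect_root e a.
  by rewrite -(e_closed ac) aS (root_root e_sym).
- case: ifP => // bS [<-] [/esym/eqP]; rewrite (root_connect e_sym) => ab.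
  have ac := e_swp j aS ab; rewrite -(e_closed ac) aS.
  by congr Some; apply/eqP; rewrite (root_connect e_sym) e_sym.
- case: ifP => // bS [<-] [<-]; apply/eqP; rewrite (root_connect e_sym).
  exact: e_dist2.
Qed.

End Components.

(** * Unlabelled variables lie in the primary component *)

Section MinimalPrime.
Variables (F : fieldType) (n : nat) (r : 'I_n -> nat) (i0 : 'I_n).
Implicit Types (a b c l : idx n r) (i j k : 'I_n).
Variables (P : polyR F n r -> Prop) (lab : idx n r -> option (idx n r)).
Hypothesis minP : minimal_prime_over (slice_ideal F n r) P.
Hypothesis labP : forall a, lab a = None <-> P (xvar F a).
Hypothesis labK : forall a l, lab a = Some l -> lab l = Some l.
Hypothesis lab_swp : forall j a b l,
  lab a = Some l -> lab b = Some l -> lab (swp j a b) = Some l.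
Hypothesis lab_near : forall a b l l',
  (dist a b <= 2)%N -> lab a = Some l -> lab b = Some l' -> l = l'.
Local Notation x := (xvar F).
Local Notation J := (primary_component (slice_ideal F n r) P).

Let prP : prime_ideal P. Proof. by case: minP. Qed.
Let idP : is_ideal P. Proof. by case: prP. Qed.
Let sliceP : sub_ideal (slice_ideal F n r) P. Proof. by case: minP. Qed.
Let idI : is_ideal (slice_ideal F n r). Proof. exact: ideal_gen_ideal. Qed.
Let idJ : is_ideal J. Proof. exact: primary_component_ideal. Qed.
Let sliceJ : sub_ideal (slice_ideal F n r) J. Proof. exact: sub_primary_component. Qed.

Let labelled_notP a l : lab a = Some l -> ~ P (x a).
Proof. by move=> la /labP; rewrite la. Qed.

Let J_saturated a l f : lab a = Some l -> J (x a * f) -> J f.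
Proof. by move=> /labelled_notP; apply: primary_component_saturated. Qed.

Let lab_good : good_labelling lab.
Proof.
move=> j a b l l' dab la lb; have ll' : l = l' by apply: lab_near la lb; rewrite dab.
by split=> //; apply: lab_swp => //; rewrite ll'.
Qed.

Let P_toric f : P f <-> toric lab f = 0.
Proof.
have kerP g : toric lab g = 0 -> P g.
  apply: (toric_ker_sub idP sliceP _ _ labK lab_swp i0) => [a /labP//|a l h la].
  by case: prP => _ _ PM /PM[/(labelled_notP la)|].
split; last exact: kerP.
case: minP => _ _ minP'; apply: (minP' (fun g => toric lab g = 0)) => //.
  exact: toric_ker_prime.
exact: slice_toric_ker.
Qed.

(** Membership in [J] spreads along the slice towards [c], one coordinate at a time: a minor relates
    [x b0 * x b'] to a multiple of [x b], and [x b0] is not in [P] because the projection [b0] of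
    [b] is labelled. *)
Let J_propagate i b c c0 l : lab c0 = Some l -> (forall k, k != i -> c k = c0 k) ->
  b i = c i -> lab (swp i b c0) = Some l -> J (x b) -> J (x c).
Proof.
move=> lc0 eqcc0; have [m] := ubnP (dist b c); elim: m b => // m IH b.
rewrite ltnS => dm bci lb Jb; have [/dist0 <- //|/dist_gt0P[k bck]] := posnP (dist b c).
have ki : k != i by apply: contraNneq bck => ->; rewrite bci.
pose b0 := swp i b c0; pose b' := swp k b c.
apply: (IH b'); first exact: leq_trans (dist_swp_lt bck) dm.
- by rewrite ffunE eq_sym (negbTE ki).
- have -> : swp i b' c0 = swp k b0 c0; last exact: lab_swp.
  apply/ffunP => h; rewrite !ffunE; case: eqVneq => // hi; first by case: ifP.
  by case: eqVneq => // ->; exact: eqcc0.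
apply: (J_saturated lb); rewrite -/b0.
have db : (dist b (swp k b0 c0) <= 2)%N.
  by apply: (@dist_le2 _ _ i k) => h hi hk; rewrite !ffunE (negbTE hi) (negbTE hk).
have := sliceJ (fgen_slice F k db); rewrite /fgen.
have -> : swp k b (swp k b0 c0) = b'.
  by apply/ffunP => h; rewrite !ffunE; case: eqVneq => // ->; rewrite eqcc0.
have -> : swp k (swp k b0 c0) b = b0.
  apply/ffunP => h; rewrite !ffunE; case: eqVneq => // ->.
  by rewrite (negbTE ki).
move=> J1; have -> : x b0 * x b' =
  x b * x (swp k b0 c0) - (x b * x (swp k b0 c0) - x b' * x b0) by ring.
by apply: idealB => //; apply: idealMr.
Qed.

(* If [b] is adjacent to the component of [b0] in direction [i] and at distance
   2 from another component (that of [e]), then, going around the cube spanned by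
   [e] and [b0], x_b is congruent to x_b times an element of the maximal ideal of
   the local ring at [P]. *)
Let J_between i b b0 e l m : (forall k, k != i -> b k = b0 k) ->
  lab b0 = Some l -> lab e = Some m -> m <> l -> dist e b = 2%N -> J (x b).
Proof.
move=> eqb lb0 le ml deb.
have far : ~ (dist e b0 <= 2)%N by move=> d; apply: ml; apply: lab_near d le lb0.
have [j [k [jk ebj ebk eqeb]]] := dist2 deb.
have ji : j != i.
  apply/eqP => ji; apply: far; apply: (@dist_le2 _ _ j k) => h hj hk.
  by rewrite eqeb // eqb // -ji.
have ki : k != i.
  apply/eqP => ki; apply: far; apply: (@dist_le2 _ _ j k) => h hj hk.
  by rewrite eqeb // eqb // -ki.
pose v := swp j e b; pose u := swp j b e; pose w := swp j b0 e.
(* A label on [v], which is near both [e] and [b0], would force the labels of these two to agree. *)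
have Pv : P (x v).
  apply/labP; case Ev: (lab v) => [m'|] //; case: ml.
  have -> : m = m' by apply: lab_near le Ev; apply: leq_trans (dist_swp j e b) _.
  apply: lab_near Ev lb0; apply: (@dist_le2 _ _ i k) => h hi hk.
  by rewrite ffunE -(eqb h hi); case: eqVneq => // hj; rewrite eqeb.
have dub : (dist u b0 <= 2)%N.
  by apply: (@dist_le2 _ _ i j) => h hi hj; rewrite ffunE (negbTE hj) eqb.
have deb' : (dist e b <= 2)%N by rewrite deb.
have I1 := fgen_slice F j deb'; have := fgen_slice F i dub; rewrite /fgen.
have -> : swp i u b0 = w.
  apply/ffunP => h; rewrite !ffunE; case: (eqVneq h i) => [->|hi].
    by rewrite eq_sym (negbTE ji).
  by case: ifP => // _; apply: eqb.
have -> : swp i b0 u = b.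
  apply/ffunP => h; rewrite !ffunE; case: (eqVneq h i) => [->|hi].
    by rewrite eq_sym (negbTE ji).
  by rewrite eqb.
move=> I2; exists (x e * x b0 - x v * x w); split.
  move=> Ps; have : P (x e * x b0).
    by rewrite -(subrK (x v * x w) (x e * x b0)); apply: idealD => //; apply: idealMr.
  by apply: prime_notM => //; apply: labelled_notP; [exact: le|exact: lb0].
have -> : (x e * x b0 - x v * x w) * x b =
  x b0 * (x e * x b - x v * x u) + x v * (x u * x b0 - x w * x b) by ring.
by apply: idealD => //; apply: idealMl.
Qed.

(* If [J_between] applies nowhere on the slice through [c], the component of [c0]
   could be enlarged by that slice, against the minimality of [P]. *)
Let J_adjacent i c c0 l : lab c = None -> lab c0 = Some l ->
  (forall k, k != i -> c k = c0 k) -> J (x c).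
Proof.
move=> lc lc0 eqcc0.
pose A b := (b i == c i) && (lab (swp i b c0) == Some l).
have A_new b : A b -> lab b = None.
  case/andP=> /eqP bci /eqP lb; case Eb: (lab b) => [m|] //.
  have ml : m = l by apply: lab_near Eb lb; apply: leq_trans (dist_swp i b c0) _.
  suff : lab c = Some l by rewrite lc.
  have -> : c = swp i c0 b; last by apply: lab_swp => //; rewrite Eb ml.
  by apply/ffunP => h; rewrite ffunE; case: eqVneq => [->|/eqcc0].
have [[e [b [m [/andP[/eqP bci /eqP lb] le deb ml]]]]|NE] := pselect (exists e b m,
    [/\ A b, lab e = Some m, dist e b = 2%N & m <> l]).
  apply: (J_propagate lc0 eqcc0 bci lb); apply: (@J_between i b (swp i b c0)) lb le ml deb.
  by move=> k ki; rewrite ffunE (negbTE ki).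
exfalso; pose lab' b := if A b then Some l else lab b.
have lab'c : lab' c = Some l.
  rewrite /lab' /A eqxx; have -> : swp i c c0 = c0; last by rewrite lc0 eqxx.
  by apply/ffunP => h; rewrite ffunE; case: eqVneq => // /eqcc0.
have labE a : lab a = if (lab' a == Some l) && (a i == c i) then None else lab' a.
  rewrite /lab'; have [Aa|_] := boolP (A a).
    by case/andP: (Aa) => -> _; rewrite eqxx A_new.
  case: ifP => // /andP[/eqP la /eqP aci]; suff : lab c = Some l by rewrite lc.
  have -> : c = swp i c0 a; last exact: lab_swp.
  by apply/ffunP => h; rewrite ffunE; case: eqVneq => [->|/eqcc0].
have proj b : lab' b = Some l -> lab (swp i b c0) = Some l.
  by rewrite /lab'; case: ifP => [/andP[_ /eqP]|_ lb] //; apply: lab_swp.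
have old b : b i != c i -> lab' b = lab b by rewrite /lab' /A => /negbTE->.
have lab'_swp j a b :
    lab' a = Some l -> lab' b = Some l -> lab' (swp j a b) = Some l.
  move=> la lb; set t := swp j a b.
  have lt : lab (swp i t c0) = Some l.
    have -> : swp i t c0 = swp j (swp i a c0) (swp i b c0).
      by apply/ffunP => h; rewrite !ffunE; case: ifP => //; case: ifP.
    by apply: lab_swp; apply: proj.
  (* In the new slice the projection of [t] decides. Outside it, [t] is a swap of this projection
     with an old index [y] of the component. *)
  have [tci|tci] := eqVneq (t i) (c i); first by rewrite /lab' /A tci lt !eqxx.
  have [y ly ty] : exists2 y, lab' y = Some l & t i = y i.
    by rewrite ffunE; case: ifP; [exists b|exists a].
  rewrite old //; have -> : t = swp i (swp i t c0) y.
    apply/ffunP => h; rewrite [RHS]ffunE; case: eqVneq => [->//|/negbTE hi].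
    by rewrite [RHS]ffunE hi.
  by apply: lab_swp => //; rewrite -old // -ty.
have := minimal_prime_labelling minP P_toric _ labE lc; rewrite lab'c => H.
suff /H : good_labelling lab' by [].
have lab'A b : A b -> lab' b = Some l by rewrite /lab' => ->.
move=> j a b m m' dab.
(* By [NE], no other component is at distance 2 from an added index. *)
have near a' b' m1 : A a' -> ~~ A b' -> lab' b' = Some m1 -> dist b' a' = 2%N -> m1 = l.
  move=> Aa /negbTE nAb; rewrite /lab' nAb => lb d.
  by apply: contra_notP NE => m1l; exists b', a', m1.
have [Aa|nAa] := boolP (A a); have [Ab|nAb] := boolP (A b).
- rewrite (lab'A a Aa) (lab'A b Ab) => -[<-] [<-]; split=> //.
  by apply: lab'_swp; apply: lab'A.
- move=> la lb; have := lb; rewrite dist_sym in dab; rewrite (near _ _ _ Aa nAb lb dab).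
  move: la; rewrite (lab'A a Aa) => -[<-] lb'; split=> //.
  by apply: lab'_swp => //; apply: lab'A.
- move=> la lb; have := la; rewrite (near _ _ _ Ab nAa la dab).
  move: lb; rewrite (lab'A b Ab) => -[<-] la'; split=> //.
  by apply: lab'_swp => //; apply: lab'A.
- rewrite {1 2}/lab' (negbTE nAa) (negbTE nAb) => la lb.
  have [mm' lt] := lab_good j dab la lb; split=> //.
  by rewrite /lab'; case: ifP => // /A_new; rewrite lt.
Qed.

Let J_unlabelled c : lab c = None -> J (x c).
Proof.
move=> lc; have adj c0 l : (dist c c0 <= 1)%N -> lab c0 = Some l -> J (x c).
  rewrite leq_eqVlt ltnS leqn0 => /orP[/eqP/dist1[i _ eqc]|/eqP/dist0<-].
    by move=> lc0; apply: J_adjacent lc lc0 eqc.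
  by rewrite lc.
have [[c0 [l [d1 lc0]]]|N1] :=
  pselect (exists c0 l, (dist c c0 <= 1)%N /\ lab c0 = Some l); first exact: adj d1 lc0.
have [[c0 [l [d2 lc0]]]|N2] := pselect (exists c0 l, (dist c c0 <= 2)%N /\ lab c0 = Some l).
  have dcc0 : dist c c0 = 2%N.
    by apply/eqP; rewrite eqn_leq d2 ltnNge; apply/negP => d1; apply: N1; exists c0, l.
  have [i [j [ij _ _ eqc]]] := dist2 dcc0.
  have Js : J (x (swp i c c0)).
    case Es: (lab (swp i c c0)) => [m|].
      by case: N1; exists (swp i c c0), m; split=> //; apply: dist_swp.
    apply: (J_adjacent (i := j) Es lc0) => k kj.
    by rewrite ffunE; case: eqVneq => // ki; apply: eqc.
  apply: (J_saturated lc0).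
  rewrite mulrC -(subrK (x (swp i c c0) * x (swp i c0 c)) (x c * x c0)).
  by apply: idealD; [|exact/sliceJ/fgen_slice|apply: idealMr].
exfalso; pose lab' a := if a == c then Some c else lab a.
(* Only [c] carries the label [Some c], by [labK], so the slice in any coordinate, here [i0],
   removes exactly [c]. *)
have labE a : lab a = if (lab' a == Some c) && (a i0 == c i0) then None else lab' a.
  rewrite /lab'; case: (eqVneq a c) => [->|ac]; first by rewrite !eqxx.
  by case: ifP => // /andP[/eqP/labK]; rewrite lc.
have := minimal_prime_labelling minP P_toric _ labE lc; rewrite /lab' eqxx => H.
suff /H : good_labelling lab' by [].
move=> j a b l l' dab; rewrite /lab'; have [ac|ac] := eqVneq a c.
  rewrite -ac; case: ifP => [/eqP ba|_ _ lb]; last by case: N2; exists b, l'; rewrite -ac dab.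
  by move: dab; rewrite ba /dist (eq_card0 (A := [set _ | _])) // => k; rewrite !inE eqxx.
have [bc la|bc la lb] := eqVneq b c; first by case: N2; exists a, l; rewrite -bc dist_sym dab.
have [ll' lt] := lab_good j dab la lb; split=> //.
by case: eqP => // tc; rewrite -tc lt in lc.
Qed.

Lemma minimal_prime_sub_component : sub_ideal P J.
Proof.
move=> f /P_toric; apply: (toric_ker_sub idJ sliceJ _ _ labK lab_swp i0).
- exact: J_unlabelled.
- exact: J_saturated.
Qed.

End MinimalPrime.

(** * Labelling the variables outside a minimal prime *)

Theorem theorem5p5 (F : fieldType) (n : nat) (r : 'I_n -> nat)
  (hn : (0 < n)%N) (hr : forall i, (0 < r i)%N)
  (P : {mpoly F[#|{: idx n r}|]} -> Prop) :
  minimal_prime_over (slice_ideal F n r) P ->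
  forall f, primary_component (slice_ideal F n r) P f <-> P f.
Proof.
move=> minP f; have [prP sliceP _] := minP; split.
  exact: (primary_component_sub prP sliceP).
pose S := [set a : idx n r | ~~ `[< P (xvar F a) >]].
have S_switch j (a b : idx n r) :
    dist a b = 2%N -> a \in S -> b \in S -> swp j a b \in S.
  rewrite !inE => dab /asboolPn Pa /asboolPn Pb; apply/asboolPn => Ps.
  case: (prime_notM prP Pa Pb); have [idP _ _] := prP.
  rewrite -(subrK (xvar F (swp j a b) * xvar F (swp j b a)) (xvar F a * xvar F b)).
  apply: idealD => //; last exact: idealMr.
  by apply/sliceP/fgen_slice; rewrite dab.
have [lab [labS labK lab_swp lab_near]] := component_labelling S_switch.
apply: (minimal_prime_sub_component (Ordinal hn) minP _ labK lab_swp lab_near) => a.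
by rewrite labS inE negbK; split => /asboolP.
Qed.
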